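(* Let $G$ be a finite connected simple graph without isolated vertices on the vertex set $[n]$. If $G$ is a closed graph, then its clique complex $\Delta(G)$ is a linear quasi-tree.
   Context: Closed graph: a labelling of $G$ is a bijection $\omega:V(G)\to[n]$. $G$ is closed with respect to $\omega$ if for any two distinct edges $\{u,v\},\{u,w\}\in E(G)$ with either $\omega(u)<\omega(v)$ and $\omega(u)<\omega(w)$, or $\omega(u)>\omega(v)$ and $\omega(u)>\omega(w)$, one has $\{v,w\}\in E(G)$. $G$ is closed if there exists a labelling with respect to which it is closed. The clique complex $\Delta(G)$ is the simplicial complex on $V(G)$ whose faces are the cliques of $G$. $\langle F_i,\dots,F_q\rangle$ denotes the simplicial complex with facets $F_i,\dots,F_q$. Leaf and branch: a facet $F$ of a simplicial complex $\Delta$ is a leaf of $\Delta$ if either $F$ is the only facet of $\Delta$, or there is a facet $B\ne F$ of $\Delta$, called a branch of $F$, such that $H\cap F\subseteq B\cap F$ for all facets $H\neq F$ of $\Delta$. Linear quasi-tree: a simplicial complex $\Delta$ is a linear quasi-tree if there is an ordering $F_1,\dots,F_q$ of its (distinct) facets such that (1) $F_i$ is a leaf of the subcomplex $\langle F_i,\dots,F_q\rangle$ for all $i$; and (2) for all $i<q$, $F_{i+1}$ is the only branch of $F_i$ in $\langle F_i,\dots,F_q\rangle$. *)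

(* Defs.v *)
From mathcomp Require Import all_boot.

Set Implicit Arguments.
Unset Strict Implicit.
Unset Printing Implicit Defensive.

Record sgraph (V : finType) := SGraph {
  adj :> rel V;
  adj_sym : symmetric adj;
  adj_irr : irreflexive adj
}.

Record scomplex (V : finType) := SComplex {
  faces : {set {set V}};
  faces_sub : forall F H : {set V}, F \in faces -> H \subset F -> H \in faces
}.

Section Graphs.
Variables (V : finType) (G : sgraph V).

Definition connected_graph : Prop :=
  0 < #|V| /\ forall x y : V, connect G x y.

Definition no_isolated_vertex : Prop := forall x : V, exists y : V, G x y.

(* The edges {u, v} and {u, w} are distinct exactly when v != w. *)
Definition closed_wrt (n : nat) (omega : V -> 'I_n) : Prop :=
  forall u v w : V, G u v -> G u w -> v != w ->
    (omega u < omega v /\ omega u < omega w) \/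
    (omega v < omega u /\ omega w < omega u) ->
    G v w.

Definition closed_graph : Prop :=
  exists omega : V -> 'I_#|V|, bijective omega /\ closed_wrt omega.

(* The empty set and the singletons are cliques. *)
Definition clique (S : {set V}) : bool :=
  [forall x in S, forall y in S, (x != y) ==> G x y].

Lemma clique_sub (F H : {set V}) :
  F \in [set S | clique S] -> H \subset F -> H \in [set S | clique S].
Proof.
rewrite !inE => /forall_inP cF sHF; apply/forall_inP => x xH.
apply/forall_inP => y yH.
by have /forall_inP := cF x (subsetP sHF x xH); apply; apply: (subsetP sHF).
Qed.

Definition clique_complex : scomplex V := SComplex clique_sub.

End Graphs.

Section Complexes.
Variable V : finType.
Implicit Types (D : scomplex V) (F B H : {set V}) (Fs : seq {set V}).

Definition facet D F : bool := maxset (fun H => H \in faces D) F.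

Lemma generated_sub Fs F H :
  F \in [set K : {set V} | has (fun F' : {set V} => K \subset F') Fs] ->
  H \subset F ->
  H \in [set K : {set V} | has (fun F' : {set V} => K \subset F') Fs].
Proof.
rewrite !inE => /hasP[F' F'in sFF'] sHF; apply/hasP; exists F' => //.
exact: subset_trans sHF sFF'.
Qed.

(* When no member of Fs contains another one, the facets of this complex are
   exactly the members of Fs. *)
Definition generated Fs : scomplex V := SComplex (@generated_sub Fs).

Definition branch D F B : Prop :=
  [/\ facet D B, B != F &
      forall H, facet D H -> H != F -> H :&: F \subset B :&: F].

Definition leaf D F : Prop :=
  facet D F /\
  ((forall H, facet D H -> H = F) \/ exists B, branch D F B).

(* Fs lists F_1, ..., F_q from index 0, so drop i Fs lists the facets from the
   one of index i on. *)
Definition linear_quasi_tree D : Prop :=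
  exists Fs : seq {set V},
    [/\ uniq Fs,
        forall F, (F \in Fs) = facet D F,
        forall i, i < size Fs -> leaf (generated (drop i Fs)) (nth set0 Fs i) &
        forall i, i.+1 < size Fs ->
          forall B, branch (generated (drop i Fs)) (nth set0 Fs i) B <->
                    B = nth set0 Fs i.+1].

End Complexes.

(* Main.v *)
Require Import Defs.
From mathcomp Require Import all_boot.

(** In a connected graph closed with respect to a labelling, any two vertices
    are joined by a label-increasing path, because a turning point of a path can
    always be shortcut.  Hence vertices with consecutive labels are adjacent, and
    the lower end of an edge may be moved up as long as it stays below the other
    end.  A facet consists of its least element and all larger neighbours of that
    element.  Ordered by their least elements, the facets satisfy [F_i :&: F_k \subset F_j] for
    [i < j < k], and the least element of [F_(i.+1)] lies in [F_i] but in no [F_k]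
    with [k > i.+1]; this gives leaves and unique branches. *)

Set Implicit Arguments.
Unset Strict Implicit.
Unset Printing Implicit Defensive.

(** * A criterion for linear quasi-trees in terms of an ordered list of facets *)

Section QuasiTrees.
Variable V : finType.
Implicit Types (D : scomplex V) (F H : {set V}) (Fs : seq {set V}).

Lemma face_sub_facet D F : F \in faces D -> exists2 H, facet D H & F \subset H.
Proof. by move=> DF; have [H] := maxset_exists DF; exists H. Qed.

Lemma facet_antichain D F H : facet D F -> facet D H -> F \subset H -> F = H.
Proof. by move=> /maxsetP[_ maxF] /maxsetP[DH _] /(maxF _ DH). Qed.

Lemma facet_generated Fs :
  {in Fs &, forall F H, F \subset H -> F = H} ->
  forall F, facet (generated Fs) F = (F \in Fs).
Proof.
move=> antiFs F; apply/idP/idP => [/maxsetP[] | FsF].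
  rewrite inE => /hasP[H FsH sFH] maxF; rewrite -(maxF H) // inE.
  by apply/hasP; exists H.
apply/maxsetP; split=> [|H]; first by rewrite inE; apply/hasP; exists F.
rewrite inE => /hasP[K FsK sHK] sFH; apply/eqP; rewrite eqEsubset sFH andbT.
by rewrite (antiFs F K FsF FsK (subset_trans sFH sHK)).
Qed.

(** The third condition, with middle index [i.+1], makes the next facet a branch. A branch [F_k]
    must contain the trace of that next facet on [F_i], which the fourth condition forbids for
    [k > i.+1]. *)
Lemma linear_quasi_tree_order D Fs :
    uniq Fs -> (forall F, (F \in Fs) = facet D F) ->
    (forall i j k, i < j < k -> k < size Fs ->
       nth set0 Fs i :&: nth set0 Fs k \subset nth set0 Fs j) ->
    (forall i k, i.+1 < k < size Fs ->
       ~~ (nth set0 Fs i :&: nth set0 Fs i.+1 \subset nth set0 Fs k)) ->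
  linear_quasi_tree D.
Proof.
move=> uFs memFs meetFs nmeetFs.
have facetE i F : facet (generated (drop i Fs)) F = (F \in drop i Fs).
  apply: facet_generated => {}F H /mem_drop + /mem_drop.
  by rewrite !memFs; apply: facet_antichain.
have dropP i F : i < size Fs -> F \in drop i Fs ->
    F = nth set0 Fs i \/ exists2 k, i < k < size Fs & F = nth set0 Fs k.
  move=> ltiF; rewrite (drop_nth set0) // inE => /predU1P[|]; first by left.
  case/(nthP set0)=> k; rewrite size_drop nth_drop ltn_subRL => ltk <-.
  by right; exists (i.+1 + k); rewrite // ltk addSn ltnS leq_addr.
have nth_in i k : i <= k -> k < size Fs -> nth set0 Fs k \in drop i Fs.
  move=> leik ltk; rewrite -(subnKC leik) -nth_drop mem_nth // size_drop.
  by rewrite ltn_sub2r // (leq_ltn_trans leik).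
have branch_next i : i.+1 < size Fs ->
    branch (generated (drop i Fs)) (nth set0 Fs i) (nth set0 Fs i.+1).
  move=> lti; have lti' := ltnW lti; split; first by rewrite facetE nth_in.
    by rewrite nth_uniq // gtn_eqF.
  move=> H; rewrite facetE => /(dropP _ _ lti')[-> /eqP //|[k /andP[ltik ltk] ->]] _.
  rewrite subsetI subsetIr andbT; case: (ltngtP i.+1 k) => [lt|gt|<-].
  - by rewrite setIC meetFs // ltnSn.
  - by rewrite ltnNge ltik in gt.
  - exact: subsetIl.
exists Fs; split=> // i lti; last first.
  move=> B; split=> [[+ neqB minB]|->]; last exact: branch_next.
  rewrite facetE => /(dropP _ _ (ltnW lti))[eqB|[k /andP[ltik ltk] eqB]].
    by rewrite eqB eqxx in neqB.
  move: ltik; rewrite leq_eqVlt => /predU1P[-> //|ltik].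
  have lt_i1k: i.+1 < k < size Fs by rewrite ltik.
  have /negP[] := nmeetFs i k lt_i1k.
  have [facet_next neq_next _] := branch_next i lti.
  rewrite setIC -eqB; apply: subset_trans (minB _ facet_next neq_next) _.
  exact: subsetIl.
split; first by rewrite facetE nth_in.
(* The last facet has no successor; it is a leaf as the only remaining facet. *)
have [lti1 | lei1] := ltnP i.+1 (size Fs).
  by right; exists (nth set0 Fs i.+1); apply: branch_next.
left=> H; rewrite facetE => /(dropP _ _ lti)[//|[k /andP[ltik ltk] _]].
by rewrite ltnNge (leq_trans lei1) in ltk.
Qed.

End QuasiTrees.

Lemma cliqueP (V : finType) (G : sgraph V) (S : {set V}) :
  reflect {in S &, forall x y, x != y -> G x y} (clique G S).
Proof.
apply: (iffP forall_inP) => [cS x y xS yS | cS x xS].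
  by have /forall_inP/(_ y yS)/implyP := cS x xS.
by apply/forall_inP => y yS; apply/implyP; apply: cS.
Qed.

(** * Label-increasing paths in a closed connected graph *)

Section ClosedLabelling.
Variables (V : finType) (G : sgraph V) (omega : V -> 'I_#|V|).
Hypotheses (omega_bij : bijective omega) (G_closed : closed_wrt G omega).
Hypothesis G_connected : forall x y : V, connect G x y.

Let omega_eq x y : omega x = omega y :> nat -> x = y.
Proof. by move/val_inj; apply: (bij_inj omega_bij). Qed.

Let omega_total x y : x != y -> omega x < omega y \/ omega y < omega x.
Proof.
by move=> neq; case: ltngtP => [||/omega_eq eq]; [left|right|rewrite eq eqxx in neq].
Qed.

Definition upward x y := G x y && (omega x < omega y).

Definition up_comparable x y := connect upward x y || connect upward y x.

Lemma adj_upward x y : G x y -> upward x y \/ upward y x.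
Proof.
move=> Gxy; have neq: x != y by apply: contraTneq Gxy => ->; rewrite adj_irr.
rewrite /upward (adj_sym G y x) Gxy; exact: omega_total.
Qed.

Lemma adj_of_upper x y z : upward x z -> upward y z -> x != y -> G x y.
Proof.
move=> /andP[Gxz ltxz] /andP[Gyz ltyz] neq.
by apply: (G_closed (u := z)); rewrite 1?(adj_sym G z) //; right.
Qed.

Lemma adj_of_lower x y z : upward z x -> upward z y -> x != y -> G x y.
Proof.
move=> /andP[Gzx ltzx] /andP[Gzy ltzy] neq.
by apply: (G_closed (u := z)) => //; left.
Qed.

(** Induction on the path from [y] to [w], from its end: [x] and the vertex before [w] are both
    lower neighbours of [w], hence equal or adjacent. Either [x] is reached from [y], or that vertex
    replaces [w] and the path gets shorter. *)
Lemma up_comparable_upper x y w :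
  connect upward y w -> upward x w -> up_comparable x y.
Proof.
case/connectP=> p; elim/last_ind: p => [|p z IHp] in x w *.
  by move=> _ -> /connect1 xy; rewrite /up_comparable xy.
rewrite rcons_path last_rcons => /andP[py tz] -> xz.
have yt: connect upward y (last y p) by apply/connectP; exists p.
have [->|neq] := eqVneq x (last y p); first by rewrite /up_comparable yt orbT.
have [xt|tx] := adj_upward (adj_of_upper xz tz neq); first exact: IHp xt.
by rewrite /up_comparable (connect_trans yt (connect1 tx)) orbT.
Qed.

(** Mirror image of [up_comparable_upper], shortening the path at its start. *)
Lemma up_comparable_lower x y w :
  connect upward w y -> upward w x -> up_comparable x y.
Proof.
case/connectP=> p; elim: p => [|z p IHp] /= in x w *.
  by move=> _ -> /connect1 xy; rewrite /up_comparable xy orbT.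
move=> /andP[wz pz] eqy wx.
have zy: connect upward z y by apply/connectP; exists p.
have [->|neq] := eqVneq x z; first by rewrite /up_comparable zy.
have [xz|zx] := adj_upward (adj_of_lower wx wz neq); last exact: IHp zx.
by rewrite /up_comparable (connect_trans (connect1 xz) zy).
Qed.

Lemma up_comparableT x y : up_comparable x y.
Proof.
case/connectP: (G_connected x y) => p; elim: p x => [|z p IHp] x /=.
  by move=> _ ->; rewrite /up_comparable connect0.
(* If the edge [x z] continues the increasing path, it is appended; otherwise [z] is a turning
   point, which the two preceding lemmas remove. *)
case/andP=> Gxz pz eqy; have /orP[zy|yz] := IHp z pz eqy.
  have [xz|zx] := adj_upward Gxz; last exact: up_comparable_lower zx.
  by rewrite /up_comparable (connect_trans (connect1 xz) zy).
have [xz|zx] := adj_upward Gxz; first exact: up_comparable_upper xz.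
by rewrite /up_comparable (connect_trans yz (connect1 zx)) orbT.
Qed.

(** * Consecutive labels and the interval property of edges *)

Lemma connect_upward_le x y : connect upward x y -> omega x <= omega y.
Proof.
case/connectP=> p; elim: p x => [|z p IHp] x /=; first by move=> _ ->.
by case/andP=> /andP[_ /ltnW le_xz] pz /(IHp z pz); apply: leq_trans.
Qed.

(** Labels grow strictly along the increasing path joining [x] and [y], so its first step already
    reaches [y]. *)
Lemma adj_succ x y : omega y = (omega x).+1 :> nat -> G x y.
Proof.
move=> eq_yx; have /orP[|/connect_upward_le] := up_comparableT x y; last first.
  by rewrite eq_yx ltnn.
case/connectP=> [[|z p] /=] => [_ eqy|/andP[/andP[Gxz ltxz] pz] eqy].
  by move/eqP: eq_yx; rewrite eqy eqn_leq ltnn andbF.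
have zy: connect upward z y by apply/connectP; exists p.
rewrite (@omega_eq y z) //; apply/eqP.
by rewrite eqn_leq (connect_upward_le zy) eq_yx ltxz.
Qed.

(** Strong induction on the label of [x]: the vertex [p] labelled just below [x] is adjacent to [v]
    by induction and to [x] by [adj_succ], so [x] and [v] are both upper neighbours of [p]. *)
Lemma adj_between u x v :
  G u v -> omega u <= omega x -> omega x < omega v -> G x v.
Proof.
move=> Guv; have [g gK Kg] := omega_bij.
elim: {x}_.+1 {-2}x (ltnSn (omega x)) => // m IHm x ltxm.
rewrite leq_eqVlt => /predU1P[/omega_eq <- //|ltux ltxv].
have ltpV: (omega x).-1 < #|V| by apply: leq_ltn_trans (leq_pred _) (ltn_ord _).
pose p := g (Ordinal ltpV).
have opE: omega x = (omega p).+1 :> nat by rewrite /p Kg /= (ltn_predK ltux).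
have ltpx: omega p < omega x by rewrite opE.
have ltpv := ltn_trans ltpx ltxv.
have leup: omega u <= omega p by rewrite -ltnS -opE.
have Gpv: G p v by apply: IHm leup ltpv; apply: leq_trans ltpx _.
apply: (adj_of_lower (z := p)); rewrite /upward ?Gpv ?adj_succ ?ltpv //.
by apply: contraTneq ltxv => ->; rewrite ltnn.
Qed.

(** * Facets as upper stars of their least elements *)

Definition upper_star a : {set V} := [set x | (x == a) || upward a x].

Lemma upper_star_refl a : a \in upper_star a.
Proof. by rewrite inE eqxx. Qed.

Lemma upper_star_le a x : x \in upper_star a -> omega a <= omega x.
Proof. by rewrite inE => /predU1P[->|/andP[_ /ltnW]]. Qed.

Lemma upper_star_inj : injective upper_star.
Proof.
move=> a b eq_ab; apply/omega_eq/eqP; rewrite eqn_leq.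
by rewrite !upper_star_le // ?eq_ab ?upper_star_refl // -eq_ab upper_star_refl.
Qed.

Lemma upper_star_clique a : clique G (upper_star a).
Proof.
apply/cliqueP => x y; rewrite !inE => /predU1P[->|ax] /predU1P[->|ay] neq.
- by rewrite eqxx in neq.
- by case/andP: ay.
- by rewrite adj_sym; case/andP: ax.
- exact: adj_of_lower ax ay neq.
Qed.

Lemma upper_star_shift a b x : omega a <= omega b <= omega x ->
  x \in upper_star a -> x \in upper_star b.
Proof.
case/andP=> leab lebx; rewrite !inE => /predU1P[eqx|/andP[Gax ltax]].
  by rewrite (@omega_eq x b) ?eqxx //; apply/eqP; rewrite eqn_leq lebx eqx leab.
have [-> //|neq] := eqVneq x b.
have ltbx: omega b < omega x.
  by rewrite ltn_neqAle lebx andbT; apply: contraNneq neq => /omega_eq->.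
by rewrite /upward (adj_between Gax leab ltbx) ltbx.
Qed.

Lemma clique_sub_upper_star (F : {set V}) x : x \in F -> clique G F ->
  exists2 a, a \in F & F \subset upper_star a.
Proof.
move=> xF /cliqueP cF; case: (arg_minnP (fun y => val (omega y)) xF) => a aF mina.
exists a => //; apply/subsetP=> y yF; rewrite inE.
have [//|neq] := eqVneq y a; rewrite /upward cF // 1?eq_sym //.
by case: (omega_total neq) => //; rewrite ltnNge mina.
Qed.

Lemma facet_upper_star (F : {set V}) x : x \in F -> facet (clique_complex G) F ->
  exists2 a, omega a <= omega x & F = upper_star a.
Proof.
move=> xF /maxsetP[]; rewrite inE => /(clique_sub_upper_star xF)[a aF sFa] maxF.
exists a; first exact: upper_star_le (subsetP sFa x xF).
by rewrite [upper_star a]maxF // inE upper_star_clique.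
Qed.

(** The vertex [x] yields the nonempty clique [upper_star x], so the empty face is not maximal. *)
Lemma facet_nonempty (F : {set V}) (x : V) :
  facet (clique_complex G) F -> exists y, y \in F.
Proof.
case/maxsetP=> _ maxF; apply/set0Pn; apply: contraTneq (upper_star_refl x) => F0.
by rewrite [upper_star x]maxF ?F0 ?inE // ?upper_star_clique // sub0set.
Qed.

(** * The facets in increasing order of their least elements *)

Definition facet_minima : seq V :=
  [seq a <- sort (relpre omega leq) (enum V) |
     facet (clique_complex G) (upper_star a)].

Lemma mem_facet_minima a :
  (a \in facet_minima) = facet (clique_complex G) (upper_star a).
Proof. by rewrite mem_filter mem_sort mem_enum andbT. Qed.

Lemma facet_minima_uniq : uniq facet_minima.
Proof. by rewrite filter_uniq // sort_uniq enum_uniq. Qed.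

Lemma facet_minima_lt x0 i j : i < size facet_minima -> j < size facet_minima ->
  (omega (nth x0 facet_minima i) < omega (nth x0 facet_minima j)) = (i < j).
Proof.
have: sorted (relpre omega leq) facet_minima.
  apply: sorted_filter => [y x z|]; first exact: leq_trans.
  by apply: sort_sorted => x y; apply: leq_total.
have letr: transitive (relpre omega leq) by move=> y x z; apply: leq_trans.
have lerr: reflexive (relpre omega leq) by move=> x /=.
move=> srt lti ltj; have le := sorted_leq_nth letr lerr x0 srt.
have [ltij|leji] := ltnP i j; last first.
  by apply/negbTE; rewrite -leqNgt; apply: le.
have := le i j lti ltj (ltnW ltij); rewrite ltn_neqAle /= => ->; rewrite andbT.
apply/eqP => /omega_eq/eqP; rewrite nth_uniq ?facet_minima_uniq //.
by rewrite ltn_eqF.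
Qed.

(** With [p] labelled just below [b], a facet containing the upper star of [p] contains [b] and has
    its least element [c] strictly below [b]. Hence [c] is at or before [a] in the list, and [b]
    passes from the star of [c] to that of [a]. *)
Lemma next_minimum_in x0 i : i.+1 < size facet_minima ->
  nth x0 facet_minima i.+1 \in upper_star (nth x0 facet_minima i).
Proof.
set s := facet_minima => lti1; set a := nth x0 s i; set b := nth x0 s i.+1.
have ltab: omega a < omega b by rewrite facet_minima_lt // ltnW.
have [g gK Kg] := omega_bij.
have ltpV: (omega b).-1 < #|V| by apply: leq_ltn_trans (leq_pred _) (ltn_ord _).
pose p := g (Ordinal ltpV).
have opE: omega b = (omega p).+1 :> nat by rewrite /p Kg /= (ltn_predK ltab).
have pb: b \in upper_star p by rewrite inE /upward adj_succ // opE ltnSn orbT.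
have [|F facF sF] := @face_sub_facet _ (clique_complex G) (upper_star p).
  by rewrite inE upper_star_clique.
have [c lecp eqF] := facet_upper_star (subsetP sF p (upper_star_refl p)) facF.
have cb: b \in upper_star c by rewrite -eqF (subsetP sF).
have: c \in s by rewrite mem_facet_minima -eqF.
case/(nthP x0)=> k ltk eqc.
apply: upper_star_shift cb; rewrite (ltnW ltab) andbT leqNgt -eqc.
have ltcb: omega c < omega b by rewrite opE ltnS.
move: ltcb; rewrite -eqc facet_minima_lt // facet_minima_lt // ?ltnS -?leqNgt //.
exact: ltnW.
Qed.

Lemma clique_complex_linear_quasi_tree (x0 : V) :
  linear_quasi_tree (clique_complex G).
Proof.
set s := facet_minima.
have szs: size (map upper_star s) = size s by rewrite size_map.
have nthE i : i < size s -> nth set0 (map upper_star s) i = upper_star (nth x0 s i).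
  exact: nth_map.
apply: (@linear_quasi_tree_order _ _ (map upper_star s)).
- by rewrite (map_inj_uniq upper_star_inj) facet_minima_uniq.
- move=> F; apply/mapP/idP => [[a + ->]|facF]; first by rewrite mem_facet_minima.
  have [x xF] := facet_nonempty x0 facF.
  have [a _ eqF] := facet_upper_star xF facF.
  by exists a; rewrite // mem_facet_minima -eqF.
- move=> i j k /andP[ltij ltjk]; rewrite szs => ltk.
  have ltj := ltn_trans ltjk ltk; have lti := ltn_trans ltij ltj.
  rewrite !nthE //; apply/subsetP=> x /setIP[xi /upper_star_le lekx].
  (* The label of [x] is at least that of the least element of [F_k], hence above that of [F_j]. *)
  apply: upper_star_shift xi.
  by rewrite (leq_trans _ lekx) ltnW // facet_minima_lt.
- move=> i k; rewrite szs => /andP[ltik ltk].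
  have lti1 := ltn_trans ltik ltk; rewrite !nthE //; last exact: ltnW.
  (* The least element of [F_(i.+1)] lies strictly below that of [F_k], so outside [F_k]. *)
  apply/subsetPn; exists (nth x0 s i.+1).
    by rewrite inE next_minimum_in // upper_star_refl.
  apply: contraL ltik => /upper_star_le.
  by rewrite leqNgt facet_minima_lt.
Qed.

End ClosedLabelling.

Theorem proposition3p5 (n : nat) (G : sgraph 'I_n)
    (G_connected : connected_graph G)
    (G_no_isolated : no_isolated_vertex G)
    (G_closed : closed_graph G) :
  linear_quasi_tree (clique_complex G).
Proof.
have [/card_gt0P[x0 _] conG] := G_connected.
have [omega [omega_bij omega_closed]] := G_closed.
exact: clique_complex_linear_quasi_tree omega_bij omega_closed conG x0.
Qed.
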